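(* Let $\gamma,n$ be odd positive integers and $N$ a positive integer, and suppose $n$ starts an integral loop of length $N$ (for the map $C_\gamma$). Let $\rho$ and $\nu$ be the numbers of zeros and ones in a single period of the characteristic trajectory of $n$, $[n]$ the integral loop vector, and $\mathcal{M}_n$ the associated $\nu\times\nu$ matrix. Let $p$ be a prime and let $a\in\mathbb{Z}_{\ge 0}$ be the maximal exponent such that $p^a$ divides every component of $[n]$; let $b,c\in\mathbb{Z}_{\ge0}$ be the maximal exponents such that $p^b$ divides $\gamma$ and $p^c$ divides $2^\rho-3^\nu$. Assume that $a>0$ and $c>b-a$. Then $$\det(\mathcal{M}_n)\equiv 0\pmod p.$$
   Context: For an odd positive integer $\gamma$, $C_\gamma:\mathbb{Z}_{>0}\to\mathbb{Z}_{>0}$ is $C_\gamma(x)=3x+\gamma$ if $x$ is odd, $C_\gamma(x)=x/2$ if $x$ is even; $C_\gamma^k$ is the $k$-fold iterate ($C_\gamma^0=\mathrm{id}$). $n$ starts an integral loop of length $N$ if $N$ is the least positive integer with $C_\gamma^N(n)=n$. $\chi_\gamma^i(n)\in\{0,1\}$ is the parity of $C_\gamma^i(n)$ ($1$ if odd, $0$ if even); the characteristic trajectory is $B=(\chi_\gamma^i(n))_{i\ge0}$, and a single period consists of the indices $0\le i\le N-1$. For $n$ odd, let $0=i_0<i_1<\cdots<i_{\nu-1}\le N-1$ be the indices in $[0,N-1]$ with $\chi_\gamma^{i_j}(n)=1$. For $1\le j\le\nu-1$, $m_j$ is the number of zeros of $B$ strictly between positions $i_{j-1}$ and $i_j$,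 and $m_\nu$ is the number of zeros at positions after $i_{\nu-1}$ and at most $N-1$. The integral loop vector is $[n]=(C_\gamma^{i_0}(n),\ldots,C_\gamma^{i_{\nu-1}}(n))^T$. Let $|j|_\nu\in\{0,\ldots,\nu-1\}$ be $j$ modulo $\nu$ and $e_{j,k}$ the $\nu\times\nu$ matrix units. Then $\mathcal{D}_n=\sum_{j=1}^\nu 2^{m_j}e_{j,|j|_\nu+1}$ and $\mathcal{M}_n=\sum_{k=1}^{\nu}\mathcal{D}_n^{k-1}\sum_{j=1}^\nu e_{j,k}$ (with $\mathcal{D}_n^0$ the identity), an integer matrix. *)

(* Defs.v *)
From mathcomp Require Import all_boot all_order all_algebra.

Set Implicit Arguments.
Unset Strict Implicit.
Unset Printing Implicit Defensive.

Import GRing.Theory Num.Theory.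

(* The map is extended from positive integers to nat by 0 |-> 0; it preserves
   positivity, so iterates of a positive integer are unaffected. *)
Definition collatz (gamma x : nat) : nat :=
  if odd x then 3 * x + gamma else x %/ 2.

Definition starts_integral_loop (gamma n N : nat) : Prop :=
  [/\ 0 < N, iter N (collatz gamma) n = n &
      forall k : nat, 0 < k -> iter k (collatz gamma) n = n -> N <= k].

Definition chi (gamma n i : nat) : bool := odd (iter i (collatz gamma) n).

(* The increasing sequence i_0 < i_1 < ... of the positions of ones in
   the period [0, N - 1]. *)
Definition one_positions (gamma n N : nat) : seq nat :=
  [seq i <- iota 0 N | chi gamma n i].

Definition nu (gamma n N : nat) : nat := size (one_positions gamma n N).

Definition rho (gamma n N : nat) : nat :=
  count (fun i => ~~ chi gamma n i) (iota 0 N).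

(* Indexed from 0: gap j is the m_(j+1) of the mathematics, the number of zeros
   strictly between i_j and i_(j+1). The default value N of nth plays the role
   of i_nu, so the last gap counts the zeros after the last one and before N. *)
Definition gap (gamma n N j : nat) : nat :=
  let s := one_positions gamma n N in
  count (fun i => [&& nth N s j < i, i < nth N s j.+1 & ~~ chi gamma n i])
        (iota 0 N).

Local Open Scope ring_scope.

Definition loop_vector (gamma n N : nat) : 'cV[int]_(nu gamma n N) :=
  \col_j (iter (nth N (one_positions gamma n N) j) (collatz gamma) n)%:Z.

(* With rows and columns indexed from 0, the column |j|_nu + 1 attached to
   row j becomes the cyclic successor ordS of the row index. *)
Definition loop_D (gamma n N : nat) : 'M[int]_(nu gamma n N) :=
  \sum_(j < nu gamma n N) (2 ^+ gap gamma n N j) *: delta_mx j (ordS j).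

Definition loop_M (gamma n N : nat) : 'M[int]_(nu gamma n N) :=
  \sum_(k < nu gamma n N)
    (loop_D gamma n N ^+ k) *m (\sum_(j < nu gamma n N) delta_mx j k).

Definition is_max_exponent (P : nat -> Prop) (a : nat) : Prop :=
  P a /\ forall k : nat, P k -> (k <= a)%N.

(* Main.v *)
Require Import Defs.
From mathcomp Require Import all_boot all_order all_algebra.
From mathcomp Require Import zify.
Import GRing.Theory Num.Theory.
Local Open Scope ring_scope.

(** Write x for the loop vector, D and M for the two matrices of the loop, u for
the all-ones vector, nu and rho for the numbers of ones and zeros in a period.

From one odd term of the loop to the next, the map triples, adds gamma, and then
halves as many times as there are zeros in the gap.  This says exactly that
D x = 3 x + gamma u, where the wrap-around of D expresses that the loop closes
up ([loop_D_loop_vector]).  Iterating this affine relation nu times gives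
  D^nu x = 3^nu x + gamma (sum_k 3^(nu - 1 - k) D^k u)
([affine_iterate_mulmx]).  On the left, D is a cyclic shift with weights, so
that its nu-th power is the scalar matrix of the product of its weights, which
is 2^rho since the gaps together contain all the zeros ([loop_D_exp_nu]).
On the right, the columns of M are the vectors D^k u, so that the sum is M w with
w_k = 3^(nu - 1 - k) ([loop_M_mulmx]).  Hence
  (2^rho - 3^nu) x = gamma (M w).

The left side is divisible by p^(a + c), and a + c > b, whereas p^b is the
exact power of p in gamma: so p divides every entry of M w.  The last entry of w
is 1, so w does not vanish modulo p and M is singular modulo p; multiplying by
the adjugate makes this precise over the integers ([dvdz_det]). *)

(** * Weighted cyclic shifts *)

Section WeightedCycle.
Variables (R : comNzRingType) (n : nat) (w : 'I_n -> R).

Let W : 'M[R]_n := \sum_(j < n) w j *: delta_mx j (ordS j).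

Lemma weighted_cycle_mulmx m (A : 'M[R]_(n, m)) i k :
  (W *m A) i k = w i * A (ordS i) k.
Proof.
rewrite mxE (bigD1 (ordS i)) //= big1 => [|j neq_j].
  rewrite addr0 /W summxE (bigD1 i) //= big1 => [|j neq_j].
    by rewrite !mxE !eqxx mulr1 addr0.
  by rewrite !mxE [i == j]eq_sym (negPf neq_j) mulr0.
rewrite /W summxE big1 ?mul0r // => l _; rewrite !mxE.
by case: eqP => [<-|]; rewrite ?(negPf neq_j) ?mulr0.
Qed.

Lemma weighted_cycle_exp_mulmx m (A : 'M[R]_(n, m)) i k l :
  (W ^+ l *m A) i k =
  (\prod_(h < l) w (iter h (@ordS n) i)) * A (iter l (@ordS n) i) k.
Proof.
elim: l i => [|l IHl] i; first by rewrite big_ord0 mul1r expr0 mul1mx.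
rewrite exprS -mulmxA weighted_cycle_mulmx IHl big_ord_recl /= mulrA.
rewrite -iterSr; congr (_ * _ * _).
by apply: eq_bigr => h _; rewrite -iterSr.
Qed.

Lemma iter_ordS l (i : 'I_n) : iter l (@ordS n) i = ((i + l) %% n)%N :> nat.
Proof.
elim: l => [|l IHl]; first by rewrite addn0 modn_small.
by rewrite /= IHl -addn1 modnDml addn1 addnS.
Qed.

(** After n steps the cycle is back at its starting point and has collected each
weight once, whatever the starting point. *)
Lemma weighted_cycle_exp_size : W ^+ n = (\prod_j w j)%:M.
Proof.
apply/matrixP=> i k; rewrite -[W ^+ n]mulmx1 weighted_cycle_exp_mulmx.
have -> : iter n (@ordS n) i = i.
  by apply: val_inj; rewrite /= iter_ordS modnDr modn_small.
have inj_orbit : injective (fun h : 'I_n => iter h (@ordS n) i).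
  move=> h1 h2 /(congr1 val) /=; rewrite !iter_ordS => /eqP.
  by rewrite eqn_modDl !modn_small // => /eqP/val_inj.
by rewrite [RHS]mxE [in RHS](reindex_inj inj_orbit) mxE mulr_natr.
Qed.

End WeightedCycle.

(** * Two facts of linear algebra *)

(** A telescoping identity: the vectors [A ^+ i *m u] on the right are the
columns of a Krylov matrix, so the sum evaluates that matrix on a vector of
powers of t.  Only i < k occur, so truncation does not affect [k.-1 - i]. *)
Lemma affine_iterate_mulmx (R : comNzRingType) n (A : 'M[R]_n)
    (x u : 'cV[R]_n) (t g : R) k :
  A *m x = t *: x + g *: u ->
  A ^+ k *m x =
    t ^+ k *: x + g *: \sum_(i < k) t ^+ (k.-1 - i) *: (A ^+ i *m u).
Proof.
move=> Ax; elim: k => [|k IHk].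
  by rewrite big_ord0 scaler0 addr0 scale1r expr0 mul1mx.
rewrite exprSr -mulmxA Ax mulmxDr -!scalemxAr IHk big_ord_recr /= subnn scale1r.
rewrite !scalerDr !scalerA -exprS -addrA; congr (_ + (_ + _)).
rewrite mulrC -scalerA; congr (_ *: _).
rewrite scaler_sumr; apply: eq_bigr => i _.
rewrite scalerA -exprS; congr (_ ^+ _ *: _).
by have := ltn_ord i; lia.
Qed.

(** A vector with an entry 1 stays nonzero modulo d, so it witnesses that A is
singular modulo d.  Since [\adj A *m A] is [\det A] times the identity, the
entry 1 lets the determinant itself be read off, without reducing modulo d. *)
Lemma dvdz_det (d : int) n (A : 'M[int]_n) (y : 'cV[int]_n) i :
  y i ord0 = 1 -> (forall j, (d %| (A *m y) j ord0)%Z) -> (d %| \det A)%Z.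
Proof.
move=> yi1 dAy.
have <- : (\adj A *m (A *m y)) i ord0 = \det A.
  by rewrite mulmxA mul_adj_mx mul_scalar_mx mxE yi1 mulr1.
by rewrite mxE; apply: rpred_sum => j _; apply: dvdz_mull.
Qed.

(** * Gaps of the trajectory *)

Section Trajectory.
Local Open Scope nat_scope.
Variables gamma n N : nat.

Let T i := iter i (collatz gamma) n.
Let s := one_positions gamma n N.
Let pos j := nth N s j.

Lemma iter_collatz_even_run u m :
    (forall i, u <= i < u + m -> ~~ chi gamma n i) ->
  2 ^ m * T (u + m) = T u.
Proof.
elim: m => [|m IHm] even_run; first by rewrite addn0 mul1n.
rewrite -IHm => [|i Hi]; last by apply: even_run; lia.
have := even_run (u + m); rewrite /chi => /(_ ltac:(lia)) even_m.
rewrite expnSr -mulnA; congr (_ * _).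
rewrite addnS /T iterS {1}/collatz (negPf even_m) mulnC divnK //.
by rewrite dvdn2.
Qed.

Lemma one_positions_sorted : sorted ltn s.
Proof. by apply: sorted_filter (iota_ltn_sorted 0 N); apply: ltn_trans. Qed.

Lemma mem_one_positions i : (i \in s) = chi gamma n i && (i < N).
Proof. by rewrite mem_filter mem_iota add0n. Qed.

(** When j is the last index, [pos j.+1] is the default value N, the end of the
period; this makes the last gap behave like the others in what follows. *)
Lemma pos_bounds j : j < size s -> pos j < pos j.+1 <= N.
Proof.
move=> ltjs; have /andP[_ ltjN] : chi gamma n (pos j) && (pos j < N).
  by rewrite -mem_one_positions mem_nth.
case: (ltnP j.+1 (size s)) => [ltj1s | lesj]; last first.
  by rewrite /pos [nth N s j.+1]nth_default // leqnn andbT.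
have /andP[_ /ltnW ->] : chi gamma n (pos j.+1) && (pos j.+1 < N).
  by rewrite -mem_one_positions mem_nth.
rewrite andbT /pos.
by apply: (sorted_ltn_nth ltn_trans N one_positions_sorted); rewrite ?inE.
Qed.

Lemma even_between_ones j i :
  j < size s -> pos j < i < pos j.+1 -> ~~ chi gamma n i.
Proof.
move=> ltjs /andP[lt_ji lt_ij]; apply/negP => odd_i.
have /andP[_ leN] := pos_bounds j ltjs.
have s_i : i \in s by rewrite mem_one_positions odd_i (leq_trans lt_ij).
have ltks : index i s < size s by rewrite index_mem.
have mono := sorted_leq_nth leq_trans leqnn N
  (sub_sorted ltnW one_positions_sorted).
case: (leqP (index i s) j) => [le_kj | lt_jk].
  have := mono _ _ ltks ltjs le_kj; rewrite nth_index // => le_i.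
  by move: lt_ji; rewrite ltnNge le_i.
have ltj1s : j.+1 < size s := leq_ltn_trans lt_jk ltks.
have := mono _ _ ltj1s ltks lt_jk.
by rewrite nth_index // => le_i; move: lt_ij; rewrite ltnNge le_i.
Qed.

Lemma gapE j : j < size s -> pos j.+1 = (pos j).+1 + gap gamma n N j.
Proof.
move=> ltjs; have /andP[lt_pos leN] := pos_bounds j ltjs.
have splitN : iota 0 N = iota 0 (pos j).+1 ++
    iota (pos j).+1 (pos j.+1 - (pos j).+1) ++ iota (pos j.+1) (N - pos j.+1).
  rewrite -{2}(subnKC lt_pos) -iotaD -(iotaD 0).
  by congr iota; lia.
rewrite /gap -/s -/(pos j) -/(pos j.+1) splitN !count_cat.
rewrite [X in _ = _ + (X + _)](eq_in_count (a2 := pred0)); last first.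
  by move=> i; rewrite mem_iota /=; lia.
rewrite [X in _ = _ + (_ + (X + _))](eq_in_count (a2 := predT)); last first.
  move=> i; rewrite mem_iota (subnKC lt_pos) => /andP[lt_i lt_i'].
  by rewrite lt_i lt_i' (even_between_ones j) // lt_i.
rewrite [X in _ = _ + (_ + (_ + X))](eq_in_count (a2 := pred0)); last first.
  by move=> i; rewrite mem_iota /=; lia.
by rewrite !count_pred0 count_predT size_iota addn0 subnKC.
Qed.

Lemma step_between_ones j :
  j < size s -> 2 ^ gap gamma n N j * T (pos j.+1) = 3 * T (pos j) + gamma.
Proof.
move=> ltjs; rewrite (gapE j ltjs) iter_collatz_even_run => [|i lt_i].
  have: chi gamma n (pos j) && (pos j < N).
    by rewrite -mem_one_positions mem_nth.
  by case/andP=> odd_j _; rewrite /T iterS {1}/collatz ifT.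
by apply: (even_between_ones j i ltjs); rewrite (gapE j ltjs).
Qed.

Hypotheses (N_gt0 : 0 < N) (n_odd : odd n).

Lemma pos0 : pos 0 = 0.
Proof.
rewrite /pos /s /one_positions; case: N N_gt0 => //= k _.
by rewrite /chi /= n_odd.
Qed.

Lemma size_one_positions_gt0 : 0 < size s.
Proof.
by case Es: s mem_one_positions => [|//] /(_ 0); rewrite /chi n_odd N_gt0.
Qed.

(** The gap lengths telescope: the nu ones and the zeros of all gaps fill the
period [0, N - 1], because the first one sits at position 0. *)
Lemma sum_gap : \sum_(j < nu gamma n N) gap gamma n N j = rho gamma n N.
Proof.
have telescope k : k <= size s -> pos k = k + \sum_(j < k) gap gamma n N j.
  elim: k => [|k IHk] lek; first by rewrite big_ord0 pos0.
  by rewrite gapE // IHk 1?ltnW // big_ord_recr /= addSn addnA.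
have:= telescope _ (leqnn _); rewrite /pos nth_default // => eqN.
apply/eqP; rewrite -(eqn_add2l (size s)) -eqN.
by rewrite /s /one_positions size_filter /rho count_predC size_iota.
Qed.

End Trajectory.

(** * The matrices of the loop *)

Lemma loop_D_loop_vector gamma n N :
  odd n -> starts_integral_loop gamma n N ->
  loop_D gamma n N *m loop_vector gamma n N =
    3 *: loop_vector gamma n N + gamma%:Z *: const_mx 1.
Proof.
move=> n_odd [N_gt0 loopN _]; apply/matrixP => j k; rewrite ord1.
rewrite weighted_cycle_mulmx !mxE mulr1.
(* For the last row, position N and position 0 carry the same value, since the
   loop has length N. *)
have -> : iter (nth N (one_positions gamma n N) (ordS j)) (collatz gamma) n =
          iter (nth N (one_positions gamma n N) j.+1) (collatz gamma) n.
  have := ltn_ord j; rewrite leq_eqVlt => /orP[/eqP Ej | ltj].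
    rewrite [RHS]/= [nth N _ j.+1]nth_default ?loopN; last by rewrite Ej.
    by rewrite /= Ej modnn (pos0 _ _ _ N_gt0 n_odd).
  by rewrite /= modn_small.
have := step_between_ones gamma n N j (ltn_ord j).
by move/(congr1 Posz); rewrite PoszD !PoszM -[Posz (_ ^ _)]natz natrX.
Qed.

Lemma loop_D_exp_nu gamma n N :
  odd n -> (0 < N)%N ->
  loop_D gamma n N ^+ nu gamma n N = (2 ^+ rho gamma n N)%:M.
Proof.
move=> n_odd N_gt0; rewrite weighted_cycle_exp_size.
by rewrite -sum_gap // prodrXr.
Qed.

(** The k-th column of M is D^k applied to the all-ones vector, since the factor
[\sum_j delta_mx j k] has ones in column k and zeros elsewhere. *)
Lemma loop_M_mulmx gamma n N (w : 'cV[int]_(nu gamma n N)) :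
  loop_M gamma n N *m w =
    \sum_k w k ord0 *: (loop_D gamma n N ^+ k *m const_mx 1).
Proof.
rewrite mulmx_suml; apply: eq_bigr => k _; rewrite -mulmxA scalemxAr.
congr (_ *m _); apply/matrixP => i j; rewrite ord1 mulmx_suml summxE.
rewrite (bigD1 i) //= big1 => [|h neq_h]; rewrite !mxE.
  rewrite (bigD1 k) //= big1 => [|l neq_l]; rewrite !mxE.
    by rewrite !eqxx mul1r !addr0 mulr1.
  by rewrite (negPf neq_l) andbF mul0r.
by apply: big1 => l _; rewrite mxE [i == h]eq_sym (negPf neq_h) mul0r.
Qed.

Theorem theorem1p5p4 (gamma n N p a b c : nat)
  (gamma_odd : odd gamma) (n_odd : odd n)
  (n_loop : starts_integral_loop gamma n N)
  (p_prime : prime p)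
  (a_max : is_max_exponent
     (fun k => forall j : 'I_(nu gamma n N),
        (p%:Z ^+ k %| loop_vector gamma n N j ord0)%Z) a)
  (b_max : is_max_exponent (fun k => (p ^ k %| gamma)%N) b)
  (c_max : is_max_exponent
     (fun k => (p%:Z ^+ k %| 2 ^+ rho gamma n N - 3 ^+ nu gamma n N)%Z) c)
  (a_gt0 : (0 < a)%N)
  (c_gt : b%:Z - a%:Z < c%:Z) :
  (\det (loop_M gamma n N) = 0 %[mod p%:Z])%Z.
Proof.
have [N_gt0 _ _] := n_loop.
have nu_gt0 : (0 < nu gamma n N)%N by apply: size_one_positions_gt0.
have [dvd_a _] := a_max; have [dvd_b max_b] := b_max; have [dvd_c _] := c_max.
have lt_bac : (b < a + c)%N by lia.
pose w : 'cV[int]_(nu gamma n N) := \col_k 3 ^+ ((nu gamma n N).-1 - k).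
have lt_last : ((nu gamma n N).-1 < nu gamma n N)%N by rewrite prednK.
apply/eqP; rewrite eqz_mod_dvd subr0.
apply: (dvdz_det _ _ _ w (Ordinal lt_last)) => [|j].
  by rewrite mxE /= subnn expr0.
have Mw : (2 ^+ rho gamma n N - 3 ^+ nu gamma n N) *: loop_vector gamma n N =
          gamma%:Z *: (loop_M gamma n N *m w).
  rewrite loop_M_mulmx scalerBl -[2 ^+ _ *: _]mul_scalar_mx -loop_D_exp_nu //.
  have Dx := loop_D_loop_vector _ _ _ n_odd n_loop.
  rewrite (affine_iterate_mulmx _ _ _ _ _ _ _ _ Dx).
  rewrite addrC addKr; congr (_ *: _).
  by apply: eq_bigr => k _; rewrite mxE.
have /dvdnP[g gammaE] := dvd_b.
have p_ndvd_g : ~~ (p %| g)%N.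
  apply/negP => /dvdnP[g' gE].
  suff: (b.+1 <= b)%N by rewrite ltnn.
  by apply: max_b; rewrite gammaE gE expnS -mulnA dvdn_mull.
have p_b_neq0 : p%:Z ^+ b != 0 by rewrite expf_neq0 // -lt0n prime_gt0.
(* Only p^b can be absorbed by gamma, which leaves a factor p for M w. *)
have : (p%:Z ^+ b.+1 %| gamma%:Z * (loop_M gamma n N *m w) j ord0)%Z.
  have /matrixP/(_ j ord0) := Mw; rewrite [LHS]mxE [RHS]mxE => <-.
  apply: (@dvdz_trans (p%:Z ^+ c * p%:Z ^+ a)); last exact: dvdz_mul.
  by rewrite -exprD dvdz_exp2l // addnC.
move: ((loop_M gamma n N *m w) j ord0) => y.
rewrite gammaE PoszM -[Posz (_ ^ _)]natz natrX natz mulrAC mulrC exprSr.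
by rewrite dvdz_mul2l // Gauss_dvdzr // coprimezE /= prime_coprime.
Qed.
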